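(* Let $m\ge1$ be an integer, $\alpha\in(0,1)$, and $0<\delta<\lambda_1$, where $\lambda_1$ is the smallest eigenvalue of $\mathcal A_h$. Let $N>1$ be an integer, $k_N=1/N$, $t_n=nk_N$, let $v\in V_h$, and let $U_N$ be defined by $$U_0=\delta^{-\alpha}v,\qquad U_n=r_m\big(k_N\mathcal B(\delta\mathcal I+t_{n-1}\mathcal B)^{-1}\big)U_{n-1},\quad n=1,\dots,N,\qquad \mathcal B=\mathcal A_h-\delta\mathcal I .$$ Then, for $\gamma\ge0$ with $\alpha+\gamma\le 2m$, $$\|\mathcal A_h^{-\alpha}v-U_N\|\le\widetilde c\,k_N^{\alpha+\gamma}\,\|\mathcal A_h^{\gamma}v\|$$ with $\widetilde c$ depending only on $\alpha$, $m$, $\gamma$ and $\delta$. Moreover, for any $r\in\mathbb R$, the norm on the left can be replaced by $\|\cdot\|_{h,r}$ provided that the norm on the right is replaced by $\|\mathcal A_h^\gamma v\|_{h,r}$.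
   Context: Setting. $\Omega\subset\mathbb R^d$ is a bounded domain with Lipschitz boundary, $V=H^1_0(\Omega)$, and $A(w,\phi)=\int_\Omega\big(a(x)\nabla w\cdot\nabla\phi+q(x)w\phi\big)\,dx$ is assumed bounded and coercive on $V$. $(\cdot,\cdot)$ and $\|\cdot\|$ are the $L^2(\Omega)$ inner product and norm. $V_h\subset V$ is a finite-dimensional (finite element) space of dimension $M$, and $\mathcal A_h:V_h\to V_h$ is the symmetric positive definite operator defined by $(\mathcal A_hw,\phi)=A(w,\phi)$ for all $w,\phi\in V_h$. Its eigenvalues are $0<\lambda_1\le\dots\le\lambda_M$ with $L^2(\Omega)$-orthonormal eigenvectors $\psi_1,\dots,\psi_M$; for $\sigma\in\mathbb R$, $\mathcal A_h^{\sigma}v=\sum_{j=1}^M\lambda_j^{\sigma}(v,\psi_j)\psi_j$. $\mathcal I$ is the identity. For $r\in\mathbb R$, $\|v\|_{h,r}=\big(\sum_{j=1}^M\lambda_j^{r}|(v,\psi_j)|^2\big)^{1/2}=\|\mathcal A_h^{r/2}v\|$. Padé approximation. $r_m(x)=P_m(x)/Q_m(x)$ is the diagonal Padé approximation to $(1+x)^{-\alpha}$: $P_m,Q_m$ are the polynomials of degree $m$ with $Q_m(0)=1$ for which the first $2m+1$ Maclaurin terms (powers $x^0,\dots,x^{2m}$) of $(1+x)^{-\alpha}-r_m(x)$ vanish. Explicitly, $Q_m(x)=1+\sum_{j=1}^m a_jb_j(\alpha)x^j$ and $P_m(x)=1+\sum_{j=1}^m a_jb_j(-\alpha)x^j$,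 with $b_j(\alpha)=(m+\alpha)(m-1+\alpha)\cdots(m+1-j+\alpha)$ and $a_j=\dfrac{m(m-1)\cdots(m+1-j)}{j!\,(2m)(2m-1)\cdots(2m+1-j)}$. For an operator $X$ (symmetric with nonnegative spectrum), $r_m(X)=P_m(X)Q_m(X)^{-1}$. *)

(* Defs.v *)
From HB Require Import structures.
From mathcomp Require Import all_boot all_order all_algebra.
From mathcomp Require Import all_classical all_reals all_analysis.

Set Implicit Arguments.
Unset Strict Implicit.
Unset Printing Implicit Defensive.

Import Order.TTheory GRing.Theory Num.Theory.
Import numFieldNormedType.Exports.

Local Open Scope classical_set_scope.
Local Open Scope ring_scope.

(* Borel sigma-algebra of R^n (n-fold product of the Borel sigma-algebra of R;
   the same construction as the library's instance for n-tuples). *)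

Definition rV_display : measure_display.
Proof. exact: default_measure_display. Qed.

Section measurable_rV.
Context (R : realType) (n : nat).

Let coord (i : 'I_n) (x : 'rV[R]_n) : measurableTypeR R := x ord0 i.

Let rV_set0 : g_sigma_preimage coord set0.
Proof. exact: sigma_algebra0. Qed.

Let rV_setC A : g_sigma_preimage coord A -> g_sigma_preimage coord (~` A).
Proof. exact: sigma_algebraC. Qed.

Let rV_bigcup (F : _^nat) : (forall i, g_sigma_preimage coord (F i)) ->
  g_sigma_preimage coord (\bigcup_i (F i)).
Proof. exact: sigma_algebra_bigcup. Qed.

HB.instance Definition _ := @isMeasurable.Build rV_display
  'rV[R]_n (g_sigma_preimage coord) rV_set0 rV_setC rV_bigcup.

End measurable_rV.

Section measurable_rV_lemmas.
Context (R : realType) (n : nat).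

Lemma measurable_coord (i : 'I_n) :
  measurable_fun [set: 'rV[R]_n] (fun x : 'rV[R]_n => x ord0 i).
Proof.
move=> _ Y mY; rewrite setTI; apply: sub_sigma_algebra => /=.
rewrite -bigcup_seq/=; exists i => /=; first by rewrite mem_index_enum.
by exists Y => //; rewrite setTI.
Qed.

Lemma measurable_fun_rV d (T : measurableType d) (f : T -> 'rV[R]_n) :
  (forall i, measurable_fun setT (fun x => f x ord0 i)) ->
  measurable_fun setT f.
Proof.
move=> mf.
suff: g_sigma_preimage (fun i x => (f x ord0 i : measurableTypeR R))
    `<=` measurable.
  rewrite (@g_sigma_preimage_comp _ (measurableTypeR R) n 'rV[R]_n
    (fun i x => x ord0 i)).
  by move=> prefS _ A mA; apply: prefS; exists A.
apply: smallest_sub; first exact: sigma_algebra_measurable.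
rewrite -bigcup_seq; apply: bigcup_sub => i Ii.
by move=> A [B mB <-]; exact: mf.
Qed.

End measurable_rV_lemmas.

Lemma open_measurable_rV (R : realType) n (A : set 'rV[R]_n) :
  open A -> measurable A.
Proof.
move=> oA.
pose c (p : 'rV[rat]_n) : 'rV[R]_n := \row_i ratr (p ord0 i).
pose ev k : R := k.+1%:R^-1.
have ev0 k : 0 < ev k by rewrite invr_gt0 ltr0n.
pose F (pk : 'rV[rat]_n * nat) : set 'rV[R]_n :=
  [set y | ball (c pk.1) (ev pk.2) `<=` A /\ ball (c pk.1) (ev pk.2) y].
have -> : A = \bigcup_pk F pk.
  apply/seteqP; split=> [x Ax|y [pk _] [sA /sA]//].
  have /nbhs_ballP[e /= e0 eA] : nbhs x A by apply: open_nbhs_nbhs.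
  have [k ke] : exists k, ev k < e / 2.
    have e2 : 0 < e / 2 by rewrite divr_gt0.
    exists (Num.truncn (e / 2)^-1).
    by rewrite /ev invf_plt ?posrE ?ltr0n// truncnS_gt.
  have H i : exists p : rat, `|x ord0 i - ratr p| < ev k.
    have [|p] := @rat_in_itvoo R (x ord0 i - ev k) (x ord0 i + ev k).
      by rewrite ltrBlDr -addrA ltrDl addr_gt0.
    by rewrite in_itv/= => pI; exists p; rewrite distrC ltr_distl.
  have [f fP] := choice H.
  have bx : ball (c (\row_i f i)) (ev k) x.
    split=> // i j; rewrite ord1 !mxE; have := fP j.
    by rewrite /ball /= distrC.
  exists (\row_i f i, k) => //; split=> //= y cy; apply: eA.
  apply: le_ball (ball_triangle (ball_sym bx) cy).
  by rewrite [leRHS]splitr lerD// ltW.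
apply: countable_bigcupT_measurable => // -[p k].
have [sA|nsA] := pselect (ball (c p) (ev k) `<=` A); last first.
  by rewrite (_ : F _ = set0)//; apply/seteqP; split=> // y [].
have -> : F (p, k) = \bigcap_i
    ((fun x : 'rV[R]_n => x ord0 i) @^-1` ball (c p ord0 i) (ev k)).
  apply/seteqP; split=> [y [_ [_ yB]] i _|y yB]; first exact: yB.
  by split=> //; split=> // i j; rewrite ord1; exact: yB.
apply: fin_bigcap_measurable => // i _.
rewrite -[X in measurable X]setTI; apply: measurable_coord => //.
by rewrite ball_itv; exact: measurable_itv.
Qed.

(* Lebesgue measure on R^n, by recursion on n: R^n.+1 = R x R^n. *)

Definition rV_cons (R : realType) n (p : measurableTypeR R * 'rV[R]_n) :
  'rV[R]_n.+1 := row_mx (p.1)%:M p.2.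

Definition rV_uncons (R : realType) n (x : 'rV[R]_n.+1) :
  measurableTypeR R * 'rV[R]_n := (x ord0 ord0, rsubmx (x : 'rV[R]_(1 + n))).

Lemma rV_consK (R : realType) n : cancel (@rV_cons R n) (@rV_uncons R n).
Proof.
case=> t x; rewrite /rV_uncons /rV_cons; congr pair; last exact: row_mxKr.
have -> : (ord0 : 'I_n.+1) = lshift n (ord0 : 'I_1) by exact: val_inj.
by apply: (etrans (row_mxEl _ _ _ _)); rewrite mxE eqxx mulr1n.
Qed.

Lemma measurable_rV_cons (R : realType) n : measurable_fun setT (@rV_cons R n).
Proof.
apply: measurable_fun_rV => i.
have [j ->|->] := unliftP ord0 i.
  rewrite (_ : (fun _ => _) = fun p : measurableTypeR R * 'rV[R]_n => p.2 ord0 j).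
    exact: (measurableT_comp (measurable_coord j) measurable_snd).
  apply/funext => -[t x] /=.
  have -> : lift ord0 j = rshift 1 j by exact: val_inj.
  exact: row_mxEr.
rewrite (_ : (fun _ => _) = fst); first exact: measurable_fst.
by apply/funext => p; rewrite -[RHS](congr1 fst (rV_consK p)).
Qed.

Lemma measurable_rV_uncons (R : realType) n :
  measurable_fun setT (@rV_uncons R n).
Proof.
apply/measurable_fun_pair => /=; first exact: measurable_coord.
apply: measurable_fun_rV => i.
under eq_fun do rewrite mxE.
exact: measurable_coord.
Qed.

Lemma product_sigma_finite d1 d2 (T1 : measurableType d1)
    (T2 : measurableType d2) (R : realType)
    (m1 : {sigma_finite_measure set T1 -> \bar R})
    (m2 : {sigma_finite_measure set T2 -> \bar R}) :
  sigma_finite setT (m1 \x m2)%E.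
Proof.
have /sigma_finiteP[F [TF ndF Foo]] := sigma_finiteT m1.
have /sigma_finiteP[G [TG ndG Goo]] := sigma_finiteT m2.
exists (fun n => F n `*` G n).
  rewrite -setXTT TF TG predeqE => -[x y]; split.
    move=> [/= [n _ Fnx] [k _ Gky]]; exists (maxn n k) => //; split.
    - by move: x Fnx; exact/subsetPset/ndF/leq_maxl.
    - by move: y Gky; exact/subsetPset/ndG/leq_maxr.
  by move=> [n _ []/= ? ?]; split; exists n.
move=> k; have [? ?] := Foo k; have [? ?] := Goo k.
split; first exact: measurableX.
by rewrite product_measure1E// lte_mul_pinfty// ge0_fin_numE.
Qed.

Section lebesgue_step.
Context (R : realType) (n : nat).
Variable mu : {sigma_finite_measure set 'rV[R]_n -> \bar R}.

Definition lebesgue_step : set 'rV[R]_n.+1 -> \bar R :=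
  pushforward (@lebesgue_measure R \x mu)%E (@rV_cons R n).

Let step0 : lebesgue_step set0 = 0%E.
Proof. by rewrite /lebesgue_step /pushforward preimage_set0 measure0. Qed.

Let step_ge0 A : (0 <= lebesgue_step A)%E.
Proof. by apply: measure_ge0; exact: measurable_rV_cons. Qed.

Let step_sigma_additive : semi_sigma_additive lebesgue_step.
Proof.
by apply: measure_semi_sigma_additive; exact: measurable_rV_cons.
Qed.

HB.instance Definition _ := isMeasure.Build _ _ _ lebesgue_step
  step0 step_ge0 step_sigma_additive.

Lemma lebesgue_step_sigma_finite : sigma_finite setT lebesgue_step.
Proof.
have [F FT mF] := product_sigma_finite (@lebesgue_measure R) mu.
exists (fun i => @rV_uncons R n @^-1` F i).
  by rewrite -preimage_bigcup -FT preimage_setT.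
move=> i; have [mFi Fi_oo] := mF i; split.
  by rewrite -[X in measurable X]setTI; exact: measurable_rV_uncons.
rewrite /lebesgue_step /pushforward -comp_preimage.
by rewrite (_ : _ \o _ = id)//; apply/funext => p /=; rewrite rV_consK.
Qed.

HB.instance Definition _ :=
  Measure_isSigmaFinite.Build _ _ _ lebesgue_step lebesgue_step_sigma_finite.

End lebesgue_step.

Fixpoint lebesgue_rV (R : realType) (n : nat) :
    {sigma_finite_measure set 'rV[R]_n -> \bar R} :=
  match n with
  | 0 => \d_(0 : 'rV[R]_0)
  | n'.+1 => lebesgue_step (lebesgue_rV R n')
  end.

Lemma lebesgue_rV_box (R : realType) n (a b : 'rV[R]_n) :
  (forall i, a ord0 i <= b ord0 i) ->
  lebesgue_rV R n [set x : 'rV[R]_n | forall i, a ord0 i <= x ord0 i <= b ord0 i] =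
  (\prod_i (b ord0 i - a ord0 i))%:E.
Proof.
elim: n a b => [|n IHn] a b ab.
  rewrite big_ord0 /= diracE mem_set//=.
  by case.
have cons0 (p : measurableTypeR R * 'rV[R]_n) : rV_cons p ord0 ord0 = p.1.
  exact: (congr1 fst (rV_consK p)).
have consS (p : measurableTypeR R * 'rV[R]_n) j :
    rV_cons p ord0 (lift ord0 j) = p.2 ord0 j.
  have -> : lift ord0 j = rshift 1 j by exact: val_inj.
  exact: row_mxEr.
pose tl (x : 'rV[R]_n.+1) : 'rV[R]_n := \row_j x ord0 (lift ord0 j).
have -> : lebesgue_rV R n.+1
      [set x : 'rV[R]_n.+1 | forall i, a ord0 i <= x ord0 i <= b ord0 i]
    = (@lebesgue_measure R \x lebesgue_rV R n)%E
        (`[a ord0 ord0, b ord0 ord0]%classic `*`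
         [set x : 'rV[R]_n | forall i, tl a ord0 i <= x ord0 i <= tl b ord0 i]).
  congr ((_ \x _)%E _); apply/seteqP; split=> [[t x]|[t x]] /=.
    move=> H; split; first by have := H ord0; rewrite cons0 in_itv.
    by move=> i; have := H (lift ord0 i); rewrite consS !mxE.
  move=> [Ht Hx] i; have [j ->|->] := unliftP ord0 i.
    by have := Hx j; rewrite consS !mxE.
  by rewrite cons0; rewrite in_itv/= in Ht.
rewrite product_measure1E//; last first.
  rewrite (_ : [set _ | _] = \bigcap_i
     ((fun x : 'rV[R]_n => x ord0 i) @^-1` `[tl a ord0 i, tl b ord0 i]%classic)).
    apply: fin_bigcap_measurable => // i _.
    by rewrite -[X in measurable X]setTI; exact: measurable_coord.
  apply/seteqP; split=> x /= H i; first by move=> _ /=; rewrite in_itv /= H.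
  by have := H i I; rewrite /= in_itv.
rewrite IHn; last by move=> i; rewrite !mxE.
have := lebesgue_measure_itv `[a ord0 ord0, b ord0 ord0].
rewrite /= lte_fin big_ord_recl => mE.
have -> : @lebesgue_measure R `[a ord0 ord0, b ord0 ord0]%classic =
    (b ord0 ord0 - a ord0 ord0)%:E.
  apply: (etrans mE); case: ltP => [_|ba]; first by rewrite -EFinB.
  by rewrite (le_anti (introT andP (conj ba (ab ord0)))) subrr.
by rewrite -EFinM; congr (_ * _)%:E; apply: eq_bigr => i _; rewrite !mxE.
Qed.

Section domains.
Context (R : realType) (d : nat).

(* Near each boundary point Omega is, in suitable orthonormal coordinates
   y = x Q, the set {y_0 > zeta (y_1, ..., y_d)} with zeta Lipschitz. *)
Definition lipschitz_boundary (Omega : set 'rV[R]_d.+1) :=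
  forall x0, (closure Omega `\` Omega°) x0 ->
  exists (e : R) (Q : 'M[R]_d.+1) (zeta : 'rV[R]_d -> R) (L : R),
    [/\ 0 < e, Q *m Q^T = 1%:M,
        forall y z, `|zeta y - zeta z| <= L * `|y - z| &
        forall x, ball x0 e x ->
          (Omega x <-> zeta (rsubmx (x *m Q : 'rV[R]_(1 + d)))
                       < (x *m Q) ord0 ord0)].

Definition lipschitz_domain (Omega : set 'rV[R]_d.+1) :=
  [/\ Omega !=set0, open Omega, connected Omega, bounded_set Omega &
      lipschitz_boundary Omega].

End domains.

Section sobolev.
Context (R : realType) (d : nat).
Implicit Types (Omega : set 'rV[R]_d) (u v w phi : 'rV[R]_d -> R)
  (g gw gphi : 'rV[R]_d -> 'rV[R]_d).

Definition partial (i : 'I_d) phi : 'rV[R]_d -> R :=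
  fun x => 'D_(delta_mx ord0 i) phi x.

Definition partials (s : seq 'I_d) phi := foldr partial phi s.

Definition smooth phi := forall s : seq 'I_d,
  continuous (partials s phi) /\
  forall i x, derivable (partials s phi) x (delta_mx ord0 i).

Definition test_function Omega phi := smooth phi /\
  exists K : set 'rV[R]_d,
    [/\ compact K, K `<=` Omega & forall x, ~ K x -> phi x = 0].

Definition grad phi : 'rV[R]_d -> 'rV[R]_d := fun x => \row_i partial i phi x.

Definition L2 Omega u := measurable_fun Omega u /\
  (lebesgue_rV R d).-integrable Omega (fun x => (u x ^+ 2)%:E).

Definition L2ip Omega u v : R := \int[lebesgue_rV R d]_(x in Omega) (u x * v x).

Definition weak_gradient Omega u g := forall phi, test_function Omega phi ->
  forall i, L2ip Omega u (partial i phi)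
            = - L2ip Omega (fun x => g x ord0 i) phi.

Definition H1 Omega u g :=
  [/\ L2 Omega u, forall i, L2 Omega (fun x => g x ord0 i) &
      weak_gradient Omega u g].

Definition H1norm Omega u g : R :=
  Num.sqrt (L2ip Omega u u
    + \sum_i L2ip Omega (fun x => g x ord0 i) (fun x => g x ord0 i)).

(* u belongs to H^1_0(Omega), the closure of the test functions in H^1(Omega),
   and g is its weak gradient *)
Definition H10 Omega u g := H1 Omega u g /\
  exists2 phi : nat -> 'rV[R]_d -> R, forall n, test_function Omega (phi n) &
    H1norm Omega (u \- phi n) (g \- grad (phi n)) @[n --> \oo] --> 0.

Section bilinear_form.
Variables (a : 'rV[R]_d -> 'M[R]_d) (q : 'rV[R]_d -> R).

Definition form_density w gw phi gphi : 'rV[R]_d -> R := fun x =>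
  \sum_i \sum_j a x i j * gw x ord0 j * gphi x ord0 i + q x * w x * phi x.

Definition Aform Omega w gw phi gphi : R :=
  \int[lebesgue_rV R d]_(x in Omega) form_density w gw phi gphi x.

Definition bounded_form Omega := exists C : R, forall w gw phi gphi,
  H10 Omega w gw -> H10 Omega phi gphi ->
  (lebesgue_rV R d).-integrable Omega
     (fun x => (form_density w gw phi gphi x)%:E) /\
  `|Aform Omega w gw phi gphi| <= C * H1norm Omega w gw * H1norm Omega phi gphi.

Definition coercive_form Omega := exists2 c : R, 0 < c & forall w gw,
  H10 Omega w gw -> c * H1norm Omega w gw ^+ 2 <= Aform Omega w gw w gw.

Definition admissible_form Omega :=
  [/\ forall i j, measurable_fun Omega (fun x => a x i j),
      measurable_fun Omega q,
      forall x, Omega x -> (a x)^T = a x,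
      bounded_form Omega & coercive_form Omega].

End bilinear_form.

(* A finite-dimensional subspace of H^1_0(Omega): an abstract finite-dimensional
   vector space with a linear injection into H^1_0(Omega), whose elements are
   functions modulo equality almost everywhere on Omega. *)
Record H10_subspace Omega := MkH10Subspace {
  h10_space :> vectType R;
  h10_fun : h10_space -> 'rV[R]_d -> R;
  h10_grad : h10_space -> 'rV[R]_d -> 'rV[R]_d;
  h10_funP : forall u : h10_space, H10 Omega (h10_fun u) (h10_grad u);
  h10_linear : forall (c : R) (u v : h10_space),
    {ae lebesgue_rV R d, forall x, Omega x ->
       h10_fun (c *: u + v) x = c * h10_fun u x + h10_fun v x};
  h10_inj : forall u : h10_space,
    {ae lebesgue_rV R d, forall x, Omega x -> h10_fun u x = 0} -> u = 0 }.

Definition ip Omega (Vh : H10_subspace Omega) (u v : Vh) : R :=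
  L2ip Omega (h10_fun u) (h10_fun v).

Definition Vnorm Omega (Vh : H10_subspace Omega) (u : Vh) : R :=
  Num.sqrt (ip u u).

Definition Ah_spec Omega (Vh : H10_subspace Omega)
    (a : 'rV[R]_d -> 'M[R]_d) (q : 'rV[R]_d -> R) (Ah : 'End(Vh)) :=
  forall w phi : Vh, ip (Ah w) phi =
    Aform a q Omega (h10_fun w) (h10_grad w) (h10_fun phi) (h10_grad phi).

(* Eigenvalues are listed increasingly and with multiplicity, so that
   lam ord0 is the smallest one. *)
Definition eigensystem Omega (Vh : H10_subspace Omega) (Ah : 'End(Vh)) M
    (lam : 'I_M -> R) (psi : 'I_M -> Vh) :=
  [/\ \dim {:Vh} = M,
      forall j, Ah (psi j) = lam j *: psi j,
      forall i j, ip (psi i) (psi j) = (i == j)%:R &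
      forall i j : 'I_M, (i <= j)%N -> lam i <= lam j].

Definition frac_pow Omega (Vh : H10_subspace Omega) M
    (lam : 'I_M -> R) (psi : 'I_M -> Vh) (sigma : R) (v : Vh) : Vh :=
  \sum_j (lam j `^ sigma * ip v (psi j)) *: psi j.

Definition hnorm Omega (Vh : H10_subspace Omega) M
    (lam : 'I_M -> R) (psi : 'I_M -> Vh) (r : R) (v : Vh) : R :=
  Num.sqrt (\sum_j lam j `^ r * `|ip v (psi j)| ^+ 2).

End sobolev.

Section pade.
Context (R : realType).

(* a_j and b_j(alpha); n ^_ j is the falling factorial n (n-1) ... (n+1-j). *)
Definition pade_a (m j : nat) : R := (m ^_ j)%:R / (j`! * (2 * m) ^_ j)%:R.

Definition pade_b (m j : nat) (alpha : R) : R :=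
  \prod_(i < j) (m%:R - i%:R + alpha).

(* Q_m and P_m, such that P_m(x)/Q_m(x) = (1+x)^(-alpha) + O(x^(2m+1)) *)
Definition pade_Q (m : nat) (alpha : R) : {poly R} :=
  \poly_(j < m.+1) (pade_a m j * pade_b m j alpha).

Definition pade_P (m : nat) (alpha : R) : {poly R} :=
  \poly_(j < m.+1) (pade_a m j * pade_b m j (- alpha)).

Context (V : vectType R).

Definition op_exp (X : 'End(V)) (n : nat) : 'End(V) :=
  iter n (fun Y => (X \o Y)%VF) \1%VF.

Definition op_poly (p : {poly R}) (X : 'End(V)) : 'End(V) :=
  \sum_(i < size p) p`_i *: op_exp X i.

(* r_m(X) = P_m(X) Q_m(X)^-1 *)
Definition pade_op (m : nat) (alpha : R) (X : 'End(V)) : 'End(V) :=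
  (op_poly (pade_P m alpha) X \o (op_poly (pade_Q m alpha) X)^-1)%VF.

End pade.

(* Main.v *)
Require Import Defs.
From HB Require Import structures.
From mathcomp Require Import all_boot all_order all_algebra.
From mathcomp Require Import all_classical all_reals all_analysis.
From mathcomp Require Import ring lra.

Set Implicit Arguments.
Unset Strict Implicit.
Unset Printing Implicit Defensive.

Import Order.TTheory GRing.Theory Num.Theory.
Import numFieldNormedType.Exports.

Local Open Scope classical_set_scope.
Local Open Scope ring_scope.

(** The operators of the scheme are functions of the discrete operator, so in
    the orthonormal eigenbasis everything reduces to one scalar estimate per
    eigenvalue lam, with a constant that does not depend on lam; Parseval's
    identity and [hnorm_le] then give the estimate in all the norms.

    Put tau = k (lam - delta) / delta, so that lam = delta (1 + N tau).  At step
    n + 1 the argument of r_m is x_n = tau / (1 + n tau) ([step_arg]), and the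
    product of the factors 1 + x_n telescopes to 1 + N tau ([prod_step_arg]).
    Were r_m(x) replaced by (1 + x)^(-alpha), the scheme would therefore be
    exact, and its relative error is the distance to 1 of the product of the
    factors r_m(x_n) (1 + x_n)^alpha.

    Each factor is 1 + O(x^(2m+1)) uniformly for x >= 0 ([pade_order]).  The
    numerator and the denominator of r_m solve hypergeometric differential
    equations ([pade_Q_ode]); these force the logarithmic derivative of
    r_m(x) (1 + x)^alpha to have a single monomial K x^(2m) as its numerator
    ([pade_wronskian]).

    If tau <= 1, the sum of the x_n^(2m+1) is at most 2 tau^(2m), so the
    relative error is O(tau^(2m)) ([prod_pade_r_relative]).  Since
    alpha + gamma <= 2m and tau <= (1 + N tau) / N, this is
    O(N^(-(alpha + gamma)) (1 + N tau)^(alpha + gamma)), the rate to be proved.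
    If tau > 1, the first steps need not be accurate, but the exact and the
    computed values are both O(N^(-alpha)), which the factor lam^gamma turns
    into the required rate.  For the computed value, 0 < r_m <= 1 disposes of
    the first step, and the later steps are the same scheme for the parameter
    tau / (1 + tau), which lies between 1/2 and 1 ([step_argS]). *)

(** * Diagonal Pade approximation of (1 + x)^(-alpha) *)

Section pade_polynomials.
Context (R : realType).
Implicit Types (m n : nat) (alpha : R).

Lemma pade_P_Q m alpha : pade_P m alpha = pade_Q m (- alpha).
Proof. by []. Qed.

Lemma pade_b_gt0 m n alpha : (n <= m)%N -> -1 < alpha -> 0 < pade_b m n alpha.
Proof.
move=> nm a1; apply: prodr_gt0 => i _.
have im : (i < m)%N by apply: leq_trans nm.
have : (i.+1%:R : R) <= m%:R by rewrite ler_nat.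
rewrite -natr1; lra.
Qed.

Lemma pade_b_homo m n alpha beta : (n <= m)%N -> -1 < alpha -> alpha <= beta ->
  pade_b m n alpha <= pade_b m n beta.
Proof.
move=> nm a1 ab; apply: ler_prod => i _.
have im : (i < m)%N by apply: leq_trans nm.
have : (i.+1%:R : R) <= m%:R by rewrite ler_nat.
rewrite -natr1; lra.
Qed.

Lemma pade_a_gt0 m n : (n <= m)%N -> 0 < pade_a R m n.
Proof.
move=> nm; rewrite divr_gt0// ltr0n ?ffact_gt0// muln_gt0 fact_gt0 ffact_gt0/=.
by rewrite (leq_trans nm)// mul2n -addnn leq_addr.
Qed.

Lemma coef_pade_Q m n alpha :
  (pade_Q m alpha)`_n = if (n <= m)%N then pade_a R m n * pade_b m n alpha else 0.
Proof. by rewrite coef_poly ltnS. Qed.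

(** The recursion between consecutive coefficients of a hypergeometric
    polynomial, namely 2F1(-m, -m - alpha; -2m; -x).  It also holds for
    [n >= m]: at [n = m] the factor [m - n] ends the series. *)
Lemma coef_pade_Q_rec m n alpha :
  (pade_Q m alpha)`_n.+1 * (n.+1%:R * (n%:R - (2 * m)%:R)) =
  - ((pade_Q m alpha)`_n * ((m%:R - n%:R) * (m%:R - n%:R + alpha))).
Proof.
rewrite !coef_pade_Q; have [nm|mn] := ltnP n m; last first.
  rewrite mul0r; case: leqP => [nm|]; last by rewrite mul0r oppr0.
  have -> : n = m by apply/eqP; rewrite eqn_leq nm.
  by rewrite subrr !mul0r mulr0 oppr0.
rewrite (ltnW nm) /pade_a /pade_b big_ord_recr/=.
rewrite !ffactnSr factS !natrM.
have n2m : (n < 2 * m)%N by rewrite (leq_trans nm)// mul2n -addnn leq_addr.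
rewrite !natrB ?(ltnW nm)// ?(ltnW n2m)//.
have H1 : (n`!%:R : R) != 0 by rewrite pnatr_eq0 -lt0n fact_gt0.
have H2 : ((2 * m) ^_ n)%:R != 0 :> R.
  by rewrite pnatr_eq0 -lt0n ffact_gt0 ltnW.
have H3 : (2 * m)%:R - n%:R != 0 :> R by rewrite subr_eq0 eqr_nat gtn_eqF.
have H4 : n.+1%:R != 0 :> R by rewrite pnatr_eq0.
move: H3; rewrite natrM => H3.
by field; rewrite H1 H2 H3 addrC natr1 H4.
Qed.

(** Gauss's hypergeometric equation, which on coefficients is exactly the
    recursion [coef_pade_Q_rec]. *)
Lemma pade_Q_ode m alpha (Q := pade_Q m alpha) :
  'X * (1 + 'X) * Q^`()^`() =
    ((2 * m)%:R - (1 - (2 * m)%:R - alpha%:P) * 'X) * Q^`()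
    - (m%:R * (m%:R + alpha%:P)) * Q.
Proof.
pose E := 'X * (1 + 'X) * Q^`()^`() -
    (((2 * m)%:R - (1 - (2 * m)%:R - alpha%:P) * 'X) * Q^`()
    - (m%:R * (m%:R + alpha%:P)) * Q).
apply/eqP; rewrite -subr_eq0 -/E; apply/eqP/polyP => n.
have -> : E = 'X * Q^`()^`() + 'X * ('X * Q^`()^`()) - (2 * m)%:R%:P * Q^`()
   + (1 - (2 * m)%:R - alpha)%:P * ('X * Q^`()) + (m%:R * (m%:R + alpha))%:P * Q.
  by rewrite /E !rmorphM !rmorphB !rmorphD !rmorph1 !rmorph_nat /=; ring.
have := coef_pade_Q_rec m n alpha; rewrite -/Q coef0 natrM => rec.
have XD (p : {poly R}) k : ('X * p^`())`_k = p`_k *+ k.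
  by rewrite coefXM coef_deriv; case: k.
have XXDD : ('X * ('X * Q^`()^`()))`_n = Q`_n * (n%:R * (n%:R - 1)).
  rewrite !coefXM !coef_deriv; case: n {rec} => [|[|n]] /=.
  - by rewrite mul0r mulr0.
  - by rewrite subrr !mulr0.
  - by rewrite -(mulr_natr (_ *+ _) n.+1) -(mulr_natr Q`_n.+2) -(natr1 n.+1); ring.
rewrite !coefD coefN !coefCM XXDD !XD coef_deriv.
rewrite -(mulr_natr Q`_n) -(mulr_natr Q`_n.+1) -(mulr_natr (_ * _) n).
move: rec; rewrite -[n.+1%:R]natr1; set q1 := Q`_n.+1; set q0 := Q`_n => rec.
transitivity (q1 * ((n%:R + 1) * (n%:R - 2 * m%:R)) +
   q0 * ((m%:R - n%:R) * (m%:R - n%:R + alpha))); last by rewrite rec addNr.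
by ring.
Qed.

(** Up to the factor (1 + x)^(alpha - 1), the left-hand side is the Wronskian
    of Q and (1 + x)^alpha P, which by Euler's transformation solve the same
    hypergeometric equation; divided by Q^2, this Wronskian is the derivative
    of (1 + x)^alpha P / Q.  The two differential equations give
    x D' = 2m D for this polynomial D (an instance of Abel's identity), hence
    all its coefficients vanish except that of x^(2m). *)
Lemma pade_wronskian m alpha (P := pade_P m alpha) (Q := pade_Q m alpha) :
  exists K : R,
    (P^`() * Q - P * Q^`()) * (1 + 'X) + alpha%:P * P * Q = K *: 'X^(2 * m).
Proof.
pose D := (P^`() * Q - P * Q^`()) * (1 + 'X) + alpha%:P * P * Q.
rewrite -/D.
have XD : 'X * D^`() = (2 * m)%:R * D.
  have hQ := pade_Q_ode m alpha; have hP := pade_Q_ode m (- alpha).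
  rewrite /= -/Q in hQ; rewrite /= -pade_P_Q -/P polyCN in hP.
  have -> : D^`() = (P^`()^`() * Q - P * Q^`()^`()) * (1 + 'X) +
      (P^`() * Q - P * Q^`()) + alpha%:P * (P^`() * Q + P * Q^`()).
    rewrite /D !(derivD, derivM, derivN, derivX, derivC).
    ring.
  transitivity (('X * (1 + 'X) * P^`()^`()) * Q - P * ('X * (1 + 'X) * Q^`()^`())
     + 'X * ((P^`() * Q - P * Q^`()) + alpha%:P * (P^`() * Q + P * Q^`()))).
    by ring.
  by rewrite hP hQ /D; ring.
exists D`_(2 * m); apply/polyP => n; rewrite coefZ coefXn.
have [->|nm] := eqVneq n (2 * m)%N; first by rewrite mulr1.
rewrite mulr0; have /(congr1 (fun p : {poly R} => p`_n)) := XD.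
rewrite mulr_natl coefMn coefXM coef_deriv.
have -> : (if n == 0%N then 0 else D`_n.-1.+1 *+ n.-1.+1) = D`_n *+ n.
  by case: n {nm}.
move/eqP; rewrite -(mulr_natr _ n) -(mulr_natr _ (2 * m)%N) -subr_eq0 -mulrBr mulf_eq0 => /orP[/eqP//|].
by rewrite subr_eq0 eqr_nat (negbTE nm).
Qed.

Lemma pade_Q_ge1 m alpha x : -1 < alpha -> 0 <= x -> 1 <= (pade_Q m alpha).[x].
Proof.
move=> a1 x0; rewrite /pade_Q horner_poly big_ord_recl /=.
have -> : pade_a R m 0 * pade_b m 0 alpha * x ^+ 0 = 1.
  by rewrite /pade_a /pade_b big_ord0 !ffactn0 fact0 muln1 divr1 !mul1r.
rewrite lerDl sumr_ge0// => i _.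
by rewrite !mulr_ge0 ?exprn_ge0// ltW// ?pade_a_gt0 ?pade_b_gt0// /bump/= add1n.
Qed.

Definition pade_r m alpha x : R := (pade_P m alpha).[x] / (pade_Q m alpha).[x].

Lemma pade_r_gt0 m alpha x : 0 < alpha -> alpha < 1 -> 0 <= x ->
  0 < pade_r m alpha x.
Proof.
move=> a0 a1 x0.
by rewrite divr_gt0 ?pade_P_Q// (lt_le_trans ltr01)// pade_Q_ge1//; lra.
Qed.

(** The coefficients of the numerator are dominated by those of the
    denominator, and are themselves positive because [alpha < 1]. *)
Lemma pade_r_le1 m alpha x : 0 < alpha -> alpha < 1 -> 0 <= x ->
  pade_r m alpha x <= 1.
Proof.
move=> a0 a1 x0.
have Q1 : 1 <= (pade_Q m alpha).[x] by rewrite pade_Q_ge1//; lra.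
rewrite ler_pdivrMr ?mul1r; last exact: lt_le_trans Q1.
rewrite pade_P_Q /pade_Q !horner_poly ler_sum// => i _.
have im : (i <= m)%N by rewrite -ltnS.
rewrite ler_wpM2r ?exprn_ge0// ler_wpM2l ?(ltW (pade_a_gt0 im))//.
by rewrite pade_b_homo//; lra.
Qed.

(** The function W(x) = r_m(x) (1 + x)^alpha equals 1 at 0 and, by
    [pade_wronskian], W'(x) = K x^(2m) (1 + x)^(alpha - 1) / Q(x)^2.  Both
    other factors of W' are at most 1 since [alpha < 1] and Q >= 1, so the
    bound is global on the half-line, with no Taylor remainder. *)
Lemma pade_order m alpha : 0 < alpha -> alpha < 1 ->
  exists2 K : R, 0 <= K & forall x : R, 0 <= x ->
    `|pade_r m alpha x * (1 + x) `^ alpha - 1| <= K * x ^+ (2 * m).+1.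
Proof.
move=> a0 a1; have [K hK] := pade_wronskian m alpha.
exists `|K| => // x x0.
set P := pade_P m alpha in hK; set Q := pade_Q m alpha in hK.
have Q1 (y : R) : 0 <= y -> 1 <= Q.[y] by move=> ?; rewrite pade_Q_ge1//; lra.
pose W (y : R) := P.[y] / Q.[y] * (1 + y) `^ alpha.
pose dW (y : R) := K * y ^+ (2 * m) * (1 + y) `^ (alpha - 1) / Q.[y] ^+ 2.
have dWP (y : R) : 0 <= y -> is_derive y (1 : R) W (dW y).
  move=> y0; have Qy0 : Q.[y] != 0 by rewrite gt_eqF// (lt_le_trans ltr01)// Q1.
  have y1 : 0 < 1 + y by rewrite ltr_pwDl.
  have h1 := is_derive1_powR alpha y1.
  have h2 : is_derive y (1 : R) (fun z : R => 1 + z) 1.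
    by rewrite -[X in is_derive _ _ _ X]add0r; exact: is_deriveD.
  have h3 := is_derive1_comp h1 h2.
  have h4 := is_deriveM (is_derive_poly P y) (is_deriveV Qy0 (is_derive_poly Q y)).
  have h5 := is_deriveM h4 h3.
  apply: (is_derive_eq h5).
  have /(congr1 (horner^~ y)) := hK.
  rewrite !hornerE /dW => <- /=.
  have -> : (1 + y) `^ alpha = (1 + y) * (1 + y) `^ (alpha - 1).
    rewrite -{2}(powRr1 (ltW y1)) -powRD; first by congr (_ `^ _); ring.
    by rewrite (gt_eqF y1) implybT.
  rewrite /GRing.scale /=.
  change ((horner P * (fun z : R => Q.[z]^-1)) y) with (P.[y] * Q.[y]^-1).
  set w := (1 + y) `^ (alpha - 1).
  by field.
have W0 : W 0 = 1.
  rewrite /W addr0 powR1 mulr1 !horner_coef0 /P /Q pade_P_Q !coef_pade_Q /=.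
  rewrite /pade_b !big_ord0 /pade_a !ffactn0 fact0 muln1 divr1 mulr1.
  by rewrite divff// oner_neq0.
have dW_itv y : y \in `]0, x[ -> is_derive y (1 : R) W (dW y).
  by rewrite in_itv/= => /andP[y0 _]; exact/dWP/ltW.
have cW : {within `[0, x], continuous W}.
  apply: derivable_within_continuous => y; rewrite in_itv/= => /andP[y0 _].
  by have [] := dWP y y0.
have [y + Wx] := MVT_segment x0 dW_itv cW.
rewrite in_itv/= => /andP[y0 yx].
rewrite -/(W x) -[X in _ - X]W0 Wx subr0.
have Qy := Q1 y y0; have y1 : 1 <= 1 + y by rewrite lerDl.
have pw : (1 + y) `^ (alpha - 1) <= 1.
  by rewrite (le_trans (ler_powR y1 (_ : _ <= 0)))// ?powRr0//; lra.
rewrite normrM (ger0_norm x0) exprSr mulrA ler_wpM2r// /dW.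
rewrite !normrM normfV !normrX (ger0_norm y0) (ger0_norm (powR_ge0 _ _)).
rewrite ler_pdivrMr; last by rewrite exprn_gt0// normr_gt0 gt_eqF// (lt_le_trans ltr01).
apply: ler_pM; rewrite ?mulr_ge0 ?powR_ge0 ?exprn_ge0//.
- by rewrite ler_wpM2l// lerXn2r.
- by rewrite (le_trans pw)// exprn_ege1// ger0_norm// (le_trans ler01).
Qed.

End pade_polynomials.

(** * The scheme for one eigenvalue *)

Section scalar_scheme.
Context (R : realType).
Implicit Types (m n : nat) (alpha gamma tau : R).

Definition step_arg tau n : R := tau / (1 + n%:R * tau).

Lemma step_arg_den_gt0 tau n : 0 <= tau -> 0 < 1 + n%:R * tau.
Proof. by move=> tau0; rewrite ltr_pwDl// mulr_ge0. Qed.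

Lemma step_arg_ge0 tau n : 0 <= tau -> 0 <= step_arg tau n.
Proof. by move=> tau0; rewrite divr_ge0// ltW// step_arg_den_gt0. Qed.

Lemma step_arg_le tau n : 0 <= tau -> step_arg tau n <= tau.
Proof.
move=> tau0; rewrite ler_pdivrMr ?step_arg_den_gt0// ler_peMr//.
by rewrite lerDl mulr_ge0.
Qed.

Lemma step_arg0 tau : step_arg tau 0 = tau.
Proof. by rewrite /step_arg mul0r addr0 divr1. Qed.

(** After its first step, the scheme with parameter tau is the scheme with
    parameter tau / (1 + tau) < 1: this makes large eigenvalues accessible to
    the estimate for tau <= 1. *)
Lemma step_argS tau n : 0 <= tau ->
  step_arg tau n.+1 = step_arg (tau / (1 + tau)) n.
Proof.
move=> tau0; rewrite /step_arg -natr1.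
have h1 : 1 + tau != 0 by rewrite gt_eqF// ltr_pwDl.
have h2 : 1 + tau + n%:R * tau != 0.
  by rewrite gt_eqF// ltr_pwDl ?mulr_ge0// ltr_pwDl.
by field; rewrite h1 h2.
Qed.

Lemma step_argD1 tau n : 0 <= tau ->
  1 + step_arg tau n = (1 + n.+1%:R * tau) / (1 + n%:R * tau).
Proof.
by move=> tau0; rewrite /step_arg -natr1; field; rewrite gt_eqF ?step_arg_den_gt0.
Qed.

Lemma prod_step_arg tau alpha n : 0 <= tau ->
  \prod_(i < n) (1 + step_arg tau i) `^ alpha = (1 + n%:R * tau) `^ alpha.
Proof.
move=> tau0; elim: n => [|n IH].
  by rewrite big_ord0 mul0r addr0 powR1.
rewrite big_ord_recr /= IH -powRM ?addr_ge0 ?step_arg_ge0 ?mulr_ge0//.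
congr (_ `^ _); rewrite step_argD1// mulrC divfK// gt_eqF// step_arg_den_gt0//.
Qed.

(** Comparison with a telescoping sum: x_n - x_(n+1) = x_n x_(n+1), and
    x_n <= 2 x_(n+1) as long as tau <= 1. *)
Lemma sum_step_arg_sqr tau n : 0 <= tau -> tau <= 1 ->
  \sum_(i < n) step_arg tau i ^+ 2 <= 2 * (tau - step_arg tau n).
Proof.
move=> tau0 tau1; elim: n => [|n IH].
  by rewrite big_ord0 step_arg0 subrr mulr0.
rewrite big_ord_recr /=.
have dn := step_arg_den_gt0 n tau0; have dn1 := step_arg_den_gt0 n.+1 tau0.
have telescope : step_arg tau n - step_arg tau n.+1 =
    step_arg tau n * step_arg tau n.+1.
  rewrite /step_arg; move: dn1; rewrite -natr1 => dn1.
  by field; rewrite !gt_eqF.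
have half : step_arg tau n <= 2 * step_arg tau n.+1.
  rewrite /step_arg mulrA ler_pdivrMr// mulrAC ler_pdivlMr// (mulrC 2) -mulrA.
  rewrite ler_wpM2l// -natr1.
  have : 0 <= n%:R * tau by rewrite mulr_ge0.
  lra.
have := ler_wpM2l (step_arg_ge0 n tau0) half.
rewrite (mulrCA _ 2) -telescope expr2; lra.
Qed.

(** One power of tau comes from the sum of squares; the others bound the
    remaining [2m - 1] factors x_i <= tau.  Here [1 <= m] provides the
    square. *)
Lemma sum_step_arg tau m n : 0 <= tau -> tau <= 1 -> (1 <= m)%N ->
  \sum_(i < n) step_arg tau i ^+ (2 * m).+1 <= 2 * tau ^+ (2 * m).
Proof.
move=> tau0 tau1; case: m => // m _.
have -> : (2 * m.+1)%N = (2 * m).+2 by rewrite mulnS.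
apply: (@le_trans _ _ (\sum_(i < n) tau ^+ (2 * m).+1 * step_arg tau i ^+ 2)).
  apply: ler_sum => i _; rewrite -addn2 exprD ler_wpM2r ?sqr_ge0//.
  by rewrite lerXn2r ?nnegrE ?step_arg_ge0 ?step_arg_le.
rewrite -mulr_sumr [in leRHS]exprSr (mulrCA 2) ler_wpM2l ?exprn_ge0//.
apply: le_trans (sum_step_arg_sqr n tau0 tau1) _.
by have := step_arg_ge0 n tau0; lra.
Qed.

Lemma normr_prod_sub1 n (w u : 'I_n -> R) : (forall i, `|w i - 1| <= u i) ->
  `|\prod_i w i - 1| <= expR (\sum_i u i) - 1.
Proof.
elim: n w u => [|n IH] w u wu; first by rewrite !big_ord0 expR0 subrr normr0.
rewrite !big_ord_recl expRD; set p := \prod_(i < n) _; set s := \sum_(i < n) _.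
have IHp : `|p - 1| <= expR s - 1 by apply: IH => i.
have := wu ord0; set w0 := w ord0; set u0 := u ord0 => wu0.
have eu0 : 1 + u0 <= expR u0 := expR_ge1Dx u0.
have w0le : `|w0| <= expR u0.
  rewrite -(subrK 1 w0) (le_trans (ler_normD _ _))// normr1 addrC.
  by rewrite (le_trans _ eu0)// lerD2l.
rewrite (_ : w0 * p - 1 = w0 * (p - 1) + (w0 - 1)); last by ring.
rewrite (le_trans (ler_normD _ _))// normrM.
have := ler_pM (normr_ge0 _) (normr_ge0 _) w0le IHp.
rewrite mulrBr mulr1; lra.
Qed.

Lemma expR_sub1_le (x : R) : expR x - 1 <= x * expR x.
Proof.
have := ler_wpM2r (expR_ge0 x) (expR_ge1Dx (- x)).
by rewrite -expRD addNr expR0; lra.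
Qed.

Lemma ler_powRN (a b alpha : R) : 0 <= alpha -> 0 < a -> a <= b ->
  b `^ (- alpha) <= a `^ (- alpha).
Proof.
move=> alpha0 a0 ab; have b0 := lt_le_trans a0 ab.
rewrite !powRN lef_pV2 ?posrE ?powR_gt0//.
by rewrite ge0_ler_powR// nnegrE ltW.
Qed.

(** The factor (1 + n tau)^alpha is distributed over the steps by
    [prod_step_arg], so that each factor of the product is within
    K x_i^(2m+1) of 1. *)
Lemma prod_pade_r_relative m alpha : (1 <= m)%N -> 0 < alpha -> alpha < 1 ->
  exists2 C : R, 0 <= C & forall n tau, 0 <= tau -> tau <= 1 ->
    `|(\prod_(i < n) pade_r m alpha (step_arg tau i))
        * (1 + n%:R * tau) `^ alpha - 1| <= C * tau ^+ (2 * m).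
Proof.
move=> m1 a0 a1; have [K K0 hK] := pade_order m a0 a1.
exists (2 * K * expR (2 * K)) => [|n tau tau0 tau1].
  by rewrite !mulr_ge0 ?expR_ge0.
rewrite -prod_step_arg// -big_split /=.
have {}hK i := hK _ (step_arg_ge0 i tau0).
apply: le_trans (normr_prod_sub1 (fun i : 'I_n => hK i)) _.
rewrite -mulr_sumr; set s := \sum_(i < n) _.
have s0 : 0 <= s by apply: sumr_ge0 => i _; rewrite exprn_ge0// step_arg_ge0.
have sle : s <= 2 * tau ^+ (2 * m) by exact: sum_step_arg.
have s2 : s <= 2.
  by rewrite (le_trans sle)// -[leRHS]mulr1 ler_wpM2l// exprn_ile1.
apply: le_trans (expR_sub1_le _) _.
rewrite [leRHS]mulrAC; apply: ler_pM; rewrite ?expR_ge0 ?mulr_ge0//.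
  by rewrite (mulrC 2) -mulrA ler_wpM2l.
by rewrite ler_expR mulrC ler_wpM2r.
Qed.

(** The error estimate with delta and lam scaled out: the constant depends on
    neither the number of steps nor tau, hence not on the eigenvalue. *)
Lemma scalar_scheme_error m alpha gamma : (1 <= m)%N ->
  0 < alpha -> alpha < 1 -> 0 <= gamma -> alpha + gamma <= (2 * m)%:R ->
  exists2 C : R, 0 <= C & forall n tau, (0 < n)%N -> 0 < tau ->
    `|(1 + n%:R * tau) `^ (- alpha)
        - \prod_(i < n) pade_r m alpha (step_arg tau i)|
      <= C * (n%:R `^ (- (alpha + gamma)) * (1 + n%:R * tau) `^ gamma).
Proof.
move=> m1 a0 a1 g0 ag; have [C C0 hC] := prod_pade_r_relative m1 a0 a1.
exists (3 + 2 * C) => [|n tau n0 tau0]; first by rewrite addr_ge0 ?mulr_ge0.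
have tau0' := ltW tau0.
have nR0 : 0 < n%:R :> R by rewrite ltr0n.
have s0 := step_arg_den_gt0 n tau0'.
have n_le_s (c : R) : 1 <= c -> n%:R <= 1 + n%:R * c.
  move=> c1; rewrite -[leLHS]mulr1 (le_trans (ler_wpM2l (ltW nR0) c1))// lerDr//.
have rhs0 : 0 <= n%:R `^ (- (alpha + gamma)) * (1 + n%:R * tau) `^ gamma.
  by rewrite mulr_ge0 ?powR_ge0.
have [tau1|tau1] := leP tau 1.
  set p := \prod_(i < n) _; set s := 1 + n%:R * tau in s0 rhs0 *.
  have -> : s `^ (- alpha) - p = - (s `^ (- alpha) * (p * s `^ alpha - 1)).
    rewrite mulrBr mulr1 mulrCA -powRD; last by rewrite (gt_eqF s0) implybT.
    by rewrite addNr powRr0 mulr1 opprB.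

  rewrite normrN normrM (ger0_norm (powR_ge0 _ _)).
  (* This is where alpha + gamma <= 2m enters, with n tau <= 1 + n tau. *)
  have tau_le : tau ^+ (2 * m) <= n%:R `^ (- (alpha + gamma)) * s `^ (alpha + gamma).
    rewrite -powR_mulrn// (le_trans (ger_powR _ ag))// ?tau0//.
    rewrite powRN mulrC ler_pdivlMr ?powR_gt0// -powRM//.
    rewrite ge0_ler_powR ?nnegrE ?mulr_ge0 ?(ltW s0)// ?addr_ge0 ?(ltW a0)//.
    by rewrite mulrC /s lerDr.
  apply: (@le_trans _ _ (s `^ (- alpha) *
      (C * (n%:R `^ (- (alpha + gamma)) * s `^ (alpha + gamma))))).
    rewrite ler_wpM2l ?powR_ge0// (le_trans (hC n _ tau0' tau1))//.
    by rewrite ler_wpM2l.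
  rewrite mulrCA (mulrCA (s `^ _)) -powRD; last by rewrite (gt_eqF s0) implybT.
  rewrite addrA addNr add0r ler_wpM2r//; lra.
set s := 1 + n%:R * tau in s0 rhs0 *.
have n_s : n%:R <= s by apply: n_le_s; exact: ltW.
(* For tau >= 1, n^gamma <= (1 + n tau)^gamma: it suffices to bound the exact
   and the computed values by multiples of n^(-alpha). *)
have pow_n : n%:R `^ (- alpha) <= n%:R `^ (- (alpha + gamma)) * s `^ gamma.
  have -> : - alpha = - (alpha + gamma) + gamma by ring.
  rewrite powRD; last by rewrite (gt_eqF nR0) implybT.
  by rewrite ler_wpM2l ?powR_ge0// ge0_ler_powR// nnegrE ltW.
have exact_le : s `^ (- alpha) <= n%:R `^ (- alpha) by rewrite ler_powRN ?(ltW a0).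
have r_ge0 (x : R) : 0 <= x -> 0 <= pade_r m alpha x.
  by move=> x0; rewrite ltW// pade_r_gt0.
have prod_le : \prod_(i < n) pade_r m alpha (step_arg tau i)
    <= 2 * (1 + C) * n%:R `^ (- alpha).
  case: n n0 nR0 {s s0 n_s pow_n exact_le rhs0 n_le_s} => // n _ nR0.
  rewrite big_ord_recl /= step_arg0.
  set tau' := tau / (1 + tau).
  have tau'0 : 0 <= tau' by rewrite divr_ge0// addr_ge0.
  have tau'1 : tau' <= 1 by rewrite ler_pdivrMr ?mul1r ?lerDr// ltr_pwDl.
  have tau'2 : 1 <= 2 * tau'.
    by rewrite /tau' mulrA ler_pdivlMr ?mul1r ?ltr_pwDl//; lra.
  rewrite (eq_bigr (fun i : 'I_n => pade_r m alpha (step_arg tau' i))); last first.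
    by move=> i _; rewrite /bump /= add1n step_argS.
  set p := \prod_(i < n) _.
  have p0 : 0 <= p by apply: prodr_ge0 => i _; rewrite r_ge0 ?step_arg_ge0.
  apply: (@le_trans _ _ p); first by rewrite ler_piMl// pade_r_le1.
  have d0 := step_arg_den_gt0 n tau'0.
  have : p * (1 + n%:R * tau') `^ alpha <= 1 + C.
    have := hC n _ tau'0 tau'1; rewrite -/p ler_norml => /andP[_].
    have : C * tau' ^+ (2 * m) <= C by rewrite ler_piMr// exprn_ile1.
    lra.
  rewrite -ler_pdivlMr ?powR_gt0// -powRN => /le_trans; apply.
  rewrite mulrAC mulrC ler_wpM2r ?addr_ge0//.
  (* The remaining n steps still reach half of the full scale n + 1. *)
  have half_n : n.+1%:R / 2 <= 1 + n%:R * tau'.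
    have : n%:R * 1 <= n%:R * (2 * tau') by rewrite ler_wpM2l.
    rewrite (mulrCA _ 2) -[n.+1%:R]natr1; lra.
  apply: (le_trans (ler_powRN (ltW a0) _ half_n)); first by rewrite divr_gt0.
  rewrite powRM// mulrC ler_wpM2r ?powR_ge0//.
  rewrite -(powR_inv1 (ler0n _ 2)) -powRrM mulrN mulN1r opprK.
  by rewrite -[leRHS]powRr1// ler_powR ?ler1n// ltW.
rewrite (le_trans (ler_normB _ _))// (ger0_norm (powR_ge0 _ _)).
rewrite ger0_norm; last first.
  by apply: prodr_ge0 => i _; rewrite r_ge0 ?step_arg_ge0.
have := ler_wpM2l (_ : 0 <= 3 + 2 * C) pow_n.
rewrite addr_ge0 ?mulr_ge0// => /(_ isT); lra.
Qed.

End scalar_scheme.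

(** * The L2 inner product on the discrete space *)

Section L2_inner_product.
Context (R : realType) (d : nat) (Omega : set 'rV[R]_d).
Hypothesis mOmega : measurable Omega.
Implicit Types u v : 'rV[R]_d -> R.

Lemma L2_mul_integrable u v : L2 Omega u -> L2 Omega v ->
  (lebesgue_rV R d).-integrable Omega (EFin \o (u \* v)).
Proof.
move=> [mu iu] [mv iv].
have i2 := integrableD mOmega iu iv.
apply: (le_integrable mOmega _ _ i2).
  by apply/measurable_realfun.measurable_EFinP; exact: measurable_realfun.measurable_funM.
move=> x _ /=; rewrite lee_fin [leRHS]ger0_norm ?addr_ge0 ?sqr_ge0// normrM.
rewrite -(real_normK (num_real (u x))) -(real_normK (num_real (v x))).
have := sqr_ge0 (`|u x| - `|v x|); have := mulr_ge0 (normr_ge0 (u x)) (normr_ge0 (v x)).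
lra.
Qed.

Context (Vh : H10_subspace Omega).
Implicit Types w : Vh.

Lemma h10_fun_L2 w : L2 Omega (h10_fun w).
Proof. by case: (h10_funP w) => -[]. Qed.

Lemma ipC w w' : ip w w' = ip w' w.
Proof. by apply: eq_Rintegral => x _; rewrite mulrC. Qed.

(** The elements of the discrete space are combined linearly only almost
    everywhere, which the integral does not see; integrability of the products
    is what splits it. *)
Lemma ip_linear (c : R) w1 w2 w : ip (c *: w1 + w2) w = c * ip w1 w + ip w2 w.
Proof.
have i1 := L2_mul_integrable (h10_fun_L2 w1) (h10_fun_L2 w).
have i2 := L2_mul_integrable (h10_fun_L2 w2) (h10_fun_L2 w).
have i3 := L2_mul_integrable (h10_fun_L2 (c *: w1 + w2)) (h10_fun_L2 w).
have ci1 : (lebesgue_rV R d).-integrable Omega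
    (EFin \o (fun x => c * (h10_fun w1 x * h10_fun w x))).
  exact: (integrableZl mOmega c i1).
rewrite /ip /L2ip -(RintegralZl c mOmega i1) -(RintegralD mOmega ci1 i2).
rewrite /Rintegral; congr fine; apply: ae_eq_integral => //.
- by case/integrableP: i3.
- by case/integrableP: (integrableD mOmega ci1 i2).
- apply: filterS (h10_linear c w1 w2) => x lin Ox /=.
  by rewrite lin// mulrDl mulrA.
Qed.

End L2_inner_product.

(** * Operators diagonal in an orthonormal basis *)

Section orthonormal_eigenbasis.
Context (R : realType) (V : vectType R) (form : V -> V -> R).
Context (n : nat) (psi : 'I_n -> V).
Hypothesis form_linear : forall (c : R) u v w,
  form (c *: u + v) w = c * form u w + form v w.
Hypothesis dimV : \dim {:V} = n.
Hypothesis psi_orthonormal : forall i j, form (psi i) (psi j) = (i == j)%:R.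

Lemma form0 w : form 0 w = 0.
Proof. by have := form_linear (-1) 0 0 w; rewrite scaler0 addr0 mulN1r addNr. Qed.

Lemma formD u v w : form (u + v) w = form u w + form v w.
Proof. by have := form_linear 1 u v w; rewrite scale1r mul1r. Qed.

Lemma formZ (c : R) u w : form (c *: u) w = c * form u w.
Proof. by have := form_linear c u 0 w; rewrite form0 !addr0. Qed.

Lemma formB u v w : form (u - v) w = form u w - form v w.
Proof. by rewrite formD -scaleN1r formZ mulN1r. Qed.

Lemma form_sum (I : Type) (s : seq I) (u : I -> V) w :
  form (\sum_(i <- s) u i) w = \sum_(i <- s) form (u i) w.
Proof.
elim: s => [|i s IH]; first by rewrite !big_nil form0.
by rewrite !big_cons formD IH.
Qed.

Lemma form_expansion (c : 'I_n -> R) j : form (\sum_i c i *: psi i) (psi j) = c j.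
Proof.
rewrite form_sum (bigD1 j)//= formZ psi_orthonormal eqxx mulr1.
rewrite big1 ?addr0// => i ij.
by rewrite formZ psi_orthonormal (negbTE ij) mulr0.
Qed.

Lemma orthonormal_expansion v : v = \sum_j form v (psi j) *: psi j.
Proof.
pose X := [tuple psi i | i < n].
have XE (i : 'I_n) : X`_i = psi i by rewrite -tnth_nth tnth_mktuple.
have freeX : free X.
  apply/freeP => k; under eq_bigr do rewrite XE.
  by move=> k0 i; rewrite -(form_expansion k i) k0 form0.
have basisX : basis_of fullv X.
  by rewrite basisEfree freeX subvf size_tuple dimV /=.
rewrite {1}(coord_basis basisX (memvf v)); apply: eq_bigr => i _.
rewrite XE; congr (_ *: _).
rewrite {2}(coord_basis basisX (memvf v)) -{1}(form_expansion (coord X ^~ v) i).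
by congr (form _ _); apply: eq_bigr => j _; rewrite XE.
Qed.

Lemma parseval v : (forall u w, form u w = form w u) ->
  form v v = \sum_j form v (psi j) ^+ 2.
Proof.
move=> formC; rewrite {1}(orthonormal_expansion v) form_sum.
by apply: eq_bigr => j _; rewrite formZ formC expr2.
Qed.

Definition diagonal (x : 'I_n -> R) (X : 'End(V)) := forall j, X (psi j) = x j *: psi j.

Lemma diagonal_coord x X v j : diagonal x X -> form (X v) (psi j) = x j * form v (psi j).
Proof.
move=> dX; rewrite {1}(orthonormal_expansion v) linear_sum /=.
rewrite (eq_bigr (fun i => (x i * form v (psi i)) *: psi i)) ?form_expansion//.
by move=> i _; rewrite linearZ /= dX scalerA mulrC.
Qed.

Lemma diagonal_id : diagonal (fun=> 1) \1%VF.
Proof. by move=> j; rewrite id_lfunE scale1r. Qed.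

Lemma diagonalZ c x X : diagonal x X -> diagonal (fun j => c * x j) (c *: X).
Proof. by move=> dX j; rewrite scale_lfunE dX scalerA. Qed.

Lemma diagonalD x y X Y : diagonal x X -> diagonal y Y ->
  diagonal (fun j => x j + y j) (X + Y).
Proof. by move=> dX dY j; rewrite add_lfunE dX dY scalerDl. Qed.

Lemma diagonal_comp x y X Y : diagonal x X -> diagonal y Y ->
  diagonal (fun j => x j * y j) (X \o Y)%VF.
Proof. by move=> dX dY j; rewrite comp_lfunE dY linearZ /= dX scalerA mulrC. Qed.

(** The inverse is meaningful only on injective operators; injectivity follows
    from the nonzero eigenvalues because the eigenvectors span the space. *)
Lemma diagonal_inv x X : diagonal x X -> (forall j, x j != 0) ->
  diagonal (fun j => (x j)^-1) (X^-1)%VF.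
Proof.
move=> dX x0.
have kerX : lker X == 0%VS.
  rewrite -subv0; apply/subvP => v; rewrite memv_ker memv0 => /eqP Xv0.
  rewrite (orthonormal_expansion v) big1// => j _.
  have := diagonal_coord v j dX; rewrite Xv0 form0 => /esym/eqP.
  by rewrite mulf_eq0 (negbTE (x0 j)) /= => /eqP ->; rewrite scale0r.
move=> j; rewrite -[RHS](lker0_lfunK kerX) linearZ /= dX scalerA mulVf//.
by rewrite scale1r.
Qed.

Lemma diagonal_poly p x X : diagonal x X ->
  diagonal (fun j => p.[x j]) (op_poly p X).
Proof.
move=> dX.
have dXn k : diagonal (fun j => x j ^+ k) (op_exp X k).
  elim: k => [|k IH] j; first by rewrite /op_exp /= id_lfunE scale1r.
  by rewrite exprS; exact: (diagonal_comp dX IH).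
move=> j; rewrite /op_poly sum_lfunE horner_coef scaler_suml.
by apply: eq_bigr => i _; rewrite scale_lfunE dXn scalerA.
Qed.

Lemma diagonal_pade m alpha x X : 0 < alpha -> alpha < 1 ->
  (forall j, 0 <= x j) -> diagonal x X ->
  diagonal (fun j => pade_r m alpha (x j)) (pade_op m alpha X).
Proof.
move=> a0 a1 x0 dX; apply: diagonal_comp; first exact: diagonal_poly.
apply: diagonal_inv; first exact: diagonal_poly.
by move=> j; rewrite gt_eqF// (lt_le_trans ltr01)// pade_Q_ge1//; lra.
Qed.

End orthonormal_eigenbasis.

(** Both sides are weighted l2 norms of the same coordinates, whatever the
    weight: hence the estimate holds for every [r] with the same constant. *)
Lemma hnorm_le (R : realType) (d : nat) (Omega : set 'rV[R]_d)
    (Vh : H10_subspace Omega) M (lam : 'I_M -> R) (psi : 'I_M -> Vh)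
    (r c : R) (u v : Vh) : 0 <= c ->
  (forall j, `|ip u (psi j)| <= c * `|ip v (psi j)|) ->
  hnorm lam psi r u <= c * hnorm lam psi r v.
Proof.
move=> c0 uv; rewrite /hnorm -[in leRHS](ger0_norm c0) -sqrtr_sqr -sqrtrM ?sqr_ge0//.
rewrite ler_wsqrtr// mulr_sumr ler_sum// => j _.
rewrite [leRHS]mulrCA ler_wpM2l ?powR_ge0// -exprMn.
by rewrite lerXn2r ?nnegrE ?mulr_ge0.
Qed.

(** * The error estimate *)

Theorem theorem3p5 (R : realType) (m : nat) (alpha gamma delta : R)
    (m_ge1 : (1 <= m)%N) (alpha_gt0 : 0 < alpha) (alpha_lt1 : alpha < 1)
    (delta_gt0 : 0 < delta)
    (gamma_ge0 : 0 <= gamma) (alpha_gamma : alpha + gamma <= (2 * m)%:R) :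
  exists c : R,
    forall (d : nat) (Omega : set 'rV[R]_d.+1)
      (a : 'rV[R]_d.+1 -> 'M[R]_d.+1) (q : 'rV[R]_d.+1 -> R)
      (Vh : H10_subspace Omega) (Ah : 'End(Vh))
      (M : nat) (lam : 'I_M.+1 -> R) (psi : 'I_M.+1 -> Vh)
      (N : nat) (k : R) (v : Vh) (U : nat -> Vh),
    lipschitz_domain Omega -> admissible_form a q Omega ->
    Ah_spec a q Ah -> eigensystem Ah lam psi ->
    delta < lam ord0 ->
    (1 < N)%N -> k = N%:R^-1 ->
    let B : 'End(Vh) := Ah - delta *: \1%VF in
    let t (n : nat) : R := n%:R * k in
    U 0%N = (delta `^ (- alpha)) *: v ->
    (forall n, (1 <= n <= N)%N ->
       U n = pade_op m alpha
               (k *: (B \o (delta *: \1 + t n.-1 *: B)^-1)%VF) (U n.-1)) ->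
    Vnorm (frac_pow lam psi (- alpha) v - U N)
      <= c * k `^ (alpha + gamma) * Vnorm (frac_pow lam psi gamma v)
    /\
    forall r : R,
      hnorm lam psi r (frac_pow lam psi (- alpha) v - U N)
        <= c * k `^ (alpha + gamma)
           * hnorm lam psi r (frac_pow lam psi gamma v).
Proof.
have [C C0 hC] := scalar_scheme_error m_ge1 alpha_gt0 alpha_lt1 gamma_ge0 alpha_gamma.
exists (C * delta `^ (- alpha) * delta `^ (- gamma)).
move=> d Omega a q Vh Ah M lam psi N k v U [_ openO _ _ _] _ _.
move=> [dimV eigen orth lam_homo] delta_lam N1 kE B t U0 Urec.
have ip_lin := ip_linear (open_measurable_rV openO) (Vh := Vh).
have N0 : (0 < N)%N by exact: ltn_trans N1.
have NR0 : 0 < N%:R :> R by rewrite ltr0n.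
have k0 : 0 < k by rewrite kE invr_gt0.
have mu0 j : 0 < lam j - delta by rewrite subr_gt0 (lt_le_trans delta_lam)// lam_homo.
pose tau j := k * (lam j - delta) / delta.
have tau0 j : 0 < tau j by rewrite divr_gt0// mulr_gt0.
have lamE j : lam j = delta * (1 + N%:R * tau j).
  by rewrite /tau kE; field; rewrite !gt_eqF.
have B_diag : diagonal psi (fun j => lam j - delta) B.
  move=> j; rewrite /B add_lfunE opp_lfunE scale_lfunE id_lfunE eigen.
  by rewrite -scalerBl.
(* The eigenvalue k mu / (delta + t n mu), with mu = lam j - delta, divided
   through by delta. *)
have step_diag n : diagonal psi (fun j => step_arg (tau j) n)
    (k *: (B \o (delta *: \1 + t n *: B)^-1)%VF).
  have den0 j : delta * 1 + t n * (lam j - delta) != 0.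
    by rewrite mulr1 gt_eqF// ltr_pwDl// !mulr_ge0// ltW.
  have shift_diag := diagonalD (diagonalZ delta (diagonal_id psi))
    (diagonalZ (t n) B_diag).
  have inv_diag := diagonal_inv ip_lin dimV orth shift_diag den0.
  move=> j; rewrite (diagonalZ k (diagonal_comp B_diag inv_diag)).
  congr (_ *: _); have := den0 j; rewrite /step_arg /tau /t mulr1 => den.
  have nz : 1 + n%:R * (k * (lam j - delta) / delta) != 0.
    by rewrite gt_eqF// (step_arg_den_gt0 n (ltW (tau0 j))).
  by field; rewrite (gt_eqF delta_gt0) mulrA den.
have U_coord n j : (n <= N)%N -> ip (U n) (psi j) =
    delta `^ (- alpha) * \prod_(i < n) pade_r m alpha (step_arg (tau j) i)
    * ip v (psi j).
  elim: n => [_|n IH nN]; first by rewrite big_ord0 mulr1 U0 (formZ ip_lin).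
  rewrite Urec//= (diagonal_coord ip_lin dimV orth _ _
    (diagonal_pade ip_lin dimV orth m alpha_gt0 alpha_lt1 _ (step_diag n))).
    by rewrite IH 1?ltnW// big_ord_recr /=; ring.
  by move=> i; rewrite step_arg_ge0// ltW.
have frac_coord s j : ip (frac_pow lam psi s v) (psi j) =
    lam j `^ s * ip v (psi j).
  by rewrite /frac_pow (form_expansion ip_lin orth).
set w := frac_pow lam psi (- alpha) v - U N.
have c0 : 0 <= C * delta `^ (- alpha) * delta `^ (- gamma) * k `^ (alpha + gamma).
  by rewrite !mulr_ge0 ?powR_ge0.
have w_coord j : `|ip w (psi j)| <=
    C * delta `^ (- alpha) * delta `^ (- gamma) * k `^ (alpha + gamma)
    * `|ip (frac_pow lam psi gamma v) (psi j)|.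
  rewrite /w (formB ip_lin) !frac_coord U_coord// -mulrBl !normrM mulrA.
  rewrite ler_wpM2r// lamE.
  have s0 := step_arg_den_gt0 N (ltW (tau0 j)).
  have [d0 s0'] := (ltW delta_gt0, ltW s0).
  rewrite !(powRM _ d0 s0') -mulrBr !normrM !(ger0_norm (powR_ge0 _ _)).
  apply: le_trans (ler_wpM2l (powR_ge0 _ _) (hC N (tau j) N0 (tau0 j))) _.
  have -> : N%:R `^ (- (alpha + gamma)) = k `^ (alpha + gamma).
    by rewrite kE -(powR_inv1 (ltW NR0)) -powRrM mulN1r.
  have gam : delta `^ (- gamma) * delta `^ gamma = 1.
    by rewrite powRN mulVf// gt_eqF// powR_gt0.
  by rewrite le_eqVlt; apply/orP; left; apply/eqP; rewrite -[LHS]mul1r -gam; ring.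
have Vnorm_hnorm x : Vnorm x = hnorm lam psi 0 x.
  rewrite /Vnorm /hnorm (parseval ip_lin dimV orth _ (@ipC _ _ _ Vh)).
  congr Num.sqrt; apply: eq_bigr => j _.
  by rewrite powRr0 mul1r real_normK// num_real.
by split=> [|r]; rewrite ?Vnorm_hnorm; apply: hnorm_le.
Qed.
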